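(* Let $n\in\mathbb{N}$ ($n\ge 1$), $a,b\in\mathbb{R}$, $c\in\mathbb{R}\setminus\{0\}$, let $1<p<\infty$ with $p\neq n+2$, and let $L\in\mathbb{R}$ with $L\neq\pm1$. Put $$\alpha=\frac{n+2-p}{(1-p)(2n+2)}(1+L),\qquad \beta=\frac{n+2-p}{(1-p)(2n+2)}(1-L),$$ $$g=c(y_1-a)^{n+1}+i(n+1)(y_2-b),\qquad h=c(y_1-a)^{n+1}-i(n+1)(y_2-b),\qquad f_{p,L}=g^{\alpha}h^{\beta}.$$ Then in $\mathbb{R}^2\setminus\{(a,b)\}$ (for $1<p<2$: at the points where $\nabla_0 f_{p,L}\neq 0$), $$\Delta_p f_{p,L}+iL(p-1)\|\nabla_0 f_{p,L}\|^{p-2}[Y_1,Y_2]f_{p,L}-\|\nabla_0 f_{p,L}\|^{p-2}\,\frac{L^2}{L^2-1}\,(-4)\left(\frac{(p-2)(1+np)}{2+n-p}\right)(Y_2 g^{\alpha})(Y_2h^{\beta})=0 .$$ In particular, $\Delta_p f_{p,L}+iL[Y_1,Y_2]f_{p,L}$ need not be zero: there exist parameters $n\in\mathbb{N}$ with $n\ge 1$, $a,b\in\mathbb{R}$, $c\in\mathbb{R}\setminus\{0\}$, $1<p<\infty$ with $p\neq n+2$, and $L\in\mathbb{R}$ with $L\neq\pm1$ for which this expression is not identically zero.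
   Context: The Grushin-type plane $\mathbb{G}_n$ is $\mathbb{R}^2$ with coordinates $(y_1,y_2)$ and the vector fields $Y_1=\frac{\partial}{\partial y_1}$, $Y_2=c(y_1-a)^n\frac{\partial}{\partial y_2}$, with $a\in\mathbb{R}$, $c\in\mathbb{R}\setminus\{0\}$, $n\in\mathbb{N}$, $n\ge1$. Then $[Y_1,Y_2]=Y_1Y_2-Y_2Y_1=cn(y_1-a)^{n-1}\frac{\partial}{\partial y_2}$. For a (complex-valued) function $f$, $\nabla_0 f=(Y_1f,Y_2f)$ and $\|\nabla_0 f\|^2=Y_1f\,\overline{Y_1f}+Y_2f\,\overline{Y_2f}$. The $p$-Laplacian is $$\Delta_p f=Y_1\big(\|\nabla_0 f\|^{p-2}Y_1f\big)+Y_2\big(\|\nabla_0 f\|^{p-2}Y_2f\big).$$ Branch convention: note $h=\overline{g}$ and $g\ne0$ off $(a,b)$. Near each point of $\mathbb{R}^2\setminus\{(a,b)\}$ fix any smooth branch of $\log g$, put $\log h=\overline{\log g}$, and set $g^{\alpha}=e^{\alpha\log g}$, $h^{\beta}=e^{\beta\log h}$. The identity is a local pointwise one and is asserted for every such choice of branch. *)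

(* Defs.v *)
From Stdlib Require Import Reals.
From Coquelicot Require Import Coquelicot.

Open Scope R_scope.

(** Points of the plane are pairs [z : R * R] with [fst z = y1], [snd z = y2].
    Coquelicot's [C] is also a product of two copies of [R]; functions on the
    plane are written [R * R -> C] to keep the two roles apart.  Derivatives of
    complex-valued functions of real variables are taken componentwise. *)

Definition ex_D1 (f : R * R -> C) (z : R * R) : Prop :=
  ex_derive (fun t : R => Re (f (t, snd z))) (fst z) /\
  ex_derive (fun t : R => Im (f (t, snd z))) (fst z).

Definition ex_D2 (f : R * R -> C) (z : R * R) : Prop :=
  ex_derive (fun t : R => Re (f (fst z, t))) (snd z) /\
  ex_derive (fun t : R => Im (f (fst z, t))) (snd z).

Definition D1 (f : R * R -> C) (z : R * R) : C :=
  (Derive (fun t : R => Re (f (t, snd z))) (fst z),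
   Derive (fun t : R => Im (f (t, snd z))) (fst z)).

Definition D2 (f : R * R -> C) (z : R * R) : C :=
  (Derive (fun t : R => Re (f (fst z, t))) (snd z),
   Derive (fun t : R => Im (f (fst z, t))) (snd z)).

Fixpoint Ck_on (U : R * R -> Prop) (k : nat) (f : R * R -> C) : Prop :=
  match k with
  | O => forall z, U z -> continuous f z
  | S k' => (forall z, U z -> ex_D1 f z /\ ex_D2 f z) /\
            Ck_on U k' (D1 f) /\ Ck_on U k' (D2 f)
  end.

Definition smooth_on (U : R * R -> Prop) (f : R * R -> C) : Prop :=
  forall k : nat, Ck_on U k f.

Definition Cexp (w : C) : C :=
  (exp (Re w) * cos (Im w), exp (Re w) * sin (Im w)).

(** Real power of a nonnegative base.  [Rpower] alone is unsuitable because
    [Rpower 0 s = 1] for every [s]; here [0 ^ 0 = 1], so that the weight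
    [||grad f||^(p-2)] is identically [1] when [p = 2], and [0 ^ s = 0] for
    [s > 0].  The value at base [0] and [s < 0] is irrelevant. *)
Definition rpow (x s : R) : R :=
  if Req_EM_T x 0 then (if Req_EM_T s 0 then 1 else 0) else Rpower x s.

Definition Y1 (f : R * R -> C) : R * R -> C := D1 f.

Definition Y2 (n : nat) (a c : R) (f : R * R -> C) : R * R -> C :=
  fun z => (RtoC (c * (fst z - a) ^ n) * D2 f z)%C.

Definition bracket (n : nat) (a c : R) (f : R * R -> C) : R * R -> C :=
  fun z => (Y1 (Y2 n a c f) z - Y2 n a c (Y1 f) z)%C.

Definition grad (n : nat) (a c : R) (f : R * R -> C) : R * R -> C * C :=
  fun z => (Y1 f z, Y2 n a c f z).

(** The sum below is a nonnegative real number seen in [C]. *)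
Definition grad_norm (n : nat) (a c : R) (f : R * R -> C) : R * R -> R :=
  fun z => sqrt (Re (Y1 f z * Cconj (Y1 f z)
                     + Y2 n a c f z * Cconj (Y2 n a c f z))%C).

Definition weight (p : R) (n : nat) (a c : R) (f : R * R -> C) : R * R -> C :=
  fun z => RtoC (rpow (grad_norm n a c f z) (p - 2)).

Definition plaplacian (p : R) (n : nat) (a c : R) (f : R * R -> C) :
    R * R -> C :=
  fun z => (Y1 (fun w => weight p n a c f w * Y1 f w) z
            + Y2 n a c (fun w => weight p n a c f w * Y2 n a c f w) z)%C.

(** [plaplacian] is total because [Derive] is; this says that its outer
    derivatives really exist at [z]. *)
Definition plaplacian_defined (p : R) (n : nat) (a c : R) (f : R * R -> C)
    (z : R * R) : Prop :=
  ex_D1 (fun w => weight p n a c f w * Y1 f w)%C z /\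
  ex_D2 (fun w => weight p n a c f w * Y2 n a c f w)%C z.

Definition alpha (n : nat) (p L : R) : R :=
  (INR n + 2 - p) / ((1 - p) * (2 * INR n + 2)) * (1 + L).

Definition beta (n : nat) (p L : R) : R :=
  (INR n + 2 - p) / ((1 - p) * (2 * INR n + 2)) * (1 - L).

Definition g (n : nat) (a b c : R) (z : R * R) : C :=
  (RtoC (c * (fst z - a) ^ (n + 1))
   + Ci * RtoC ((INR n + 1) * (snd z - b)))%C.

(** A smooth branch [lg] of [log g] on a neighbourhood [U] of [z]. *)
Definition log_branch_near (n : nat) (a b c : R) (z : R * R)
    (U : R * R -> Prop) (lg : R * R -> C) : Prop :=
  open U /\ U z /\ smooth_on U lg /\
  (forall w, U w -> Cexp (lg w) = g n a b c w).

(** [g^s] and [h^s] for the branch [lg] of [log g]; as [h] is the conjugate of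
    [g], the branch used for [log h] is the conjugate of [lg]. *)
Definition gpow (lg : R * R -> C) (s : R) : R * R -> C :=
  fun z => Cexp (RtoC s * lg z)%C.

Definition hpow (lg : R * R -> C) (s : R) : R * R -> C :=
  fun z => Cexp (RtoC s * Cconj (lg z))%C.

Definition fpL (n : nat) (p L : R) (lg : R * R -> C) : R * R -> C :=
  fun z => (gpow lg (alpha n p L) z * hpow lg (beta n p L) z)%C.

(* Main.v *)
Require Import Defs.
From Stdlib Require Import Reals Lra Lia.
From Coquelicot Require Import Coquelicot.
Open Scope R_scope.

(** Write phi = c (y1 - a)^n, m = n + 1, q = 1/g, r = 1/h, W = ||grad f||^(p-2)
    and f = g^s h^t.  Differentiating exp (lg) = g gives Y1 lg = m phi q and
    Y2 lg = i m phi q, so that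
      Y1 f = m phi f (s q + t r),   Y2 f = i m phi f (s q - t r).
    By the parallelogram law ||grad f||^2 = 2 (s^2 + t^2) (m phi)^2 |g|^(2(s+t-1)),
    so W is the exponential of an explicit real function wherever phi <> 0, and
    its derivatives are W times a logarithmic derivative.  The expression in the
    theorem then becomes W f times a polynomial in q, r, phi and phi'.  Its terms
    with phi' combine, because s (1 - L) = t (1 + L) for the prescribed exponents,
    into a multiple of phi' (q + r); since g + h = 2 c (y1 - a)^(n+1), this
    equals 2 n phi^2 q r, and everything is a multiple of phi^2 q r.
    The remaining scalar coefficient vanishes by a rational identity in n, p
    and L ([p_laplace_algebra], [exponent_balance]).

    On the line y1 = a the vector fields degenerate, Y2 vanishes there and so
    does grad f.  If p < 2 such points are excluded, and if p = 2 then W is the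
    constant 1 and the computation above applies verbatim.  If p > 2 then W is
    continuous and zero on the line, while Y1 f contains the factor y1 - a;
    hence W Y1 f has derivative 0 and the p-Laplacian exists and is 0, like W
    ([plaplacian_axis]).

    The same degeneration gives the counterexample to the equation without the
    correction: for n = 1 and p > 2 the p-Laplacian vanishes on the line y1 = a,
    but the bracket there is c times the derivative of f in y2, which is not
    zero.  A smooth logarithm of g is explicit on the half-plane y2 > b, where
    Im g > 0. *)

(** * Derivatives of complex-valued functions of real variables *)

Definition is_dC (F : R -> C) (t : R) (l : C) : Prop :=
  is_derive (fun s => Re (F s)) t (Re l) /\
  is_derive (fun s => Im (F s)) t (Im l).

(** Carrying existence and values of both partial derivatives in one predicate
    makes the rules below compose by term application; the total operators [D1]
    and [D2] are recovered by [partials_D1] and [partials_D2]. *)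
Definition partials (f : R * R -> C) (z : R * R) (l1 l2 : C) : Prop :=
  is_dC (fun t => f (t, snd z)) (fst z) l1 /\
  is_dC (fun t => f (fst z, t)) (snd z) l2.

Lemma C_ext (x y : C) : Re x = Re y -> Im x = Im y -> x = y.
Proof. destruct x, y; simpl; intros; subst; reflexivity. Qed.

Lemma is_dC_const (k : C) (t : R) : is_dC (fun _ => k) t 0.
Proof. split; apply @is_derive_const. Qed.

Lemma is_dC_plus (F G : R -> C) (t : R) (l m : C) :
  is_dC F t l -> is_dC G t m -> is_dC (fun s => (F s + G s)%C) t (l + m)%C.
Proof.
  intros [F1 F2] [G1 G2]; split; simpl.
  - exact (is_derive_plus _ _ _ _ _ F1 G1).
  - exact (is_derive_plus _ _ _ _ _ F2 G2).
Qed.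

Lemma is_derive_eq (f : R -> R) (x l m : R) :
  is_derive f x l -> l = m -> is_derive f x m.
Proof. intros H <-; exact H. Qed.

Lemma is_derive_Rmult (f h : R -> R) (x l m : R) :
  is_derive f x l -> is_derive h x m ->
  is_derive (fun t => f t * h t) x (l * h x + f x * m).
Proof.
  intros Hf Hh.
  exact (is_derive_mult f h x l m Hf Hh Rmult_comm).
Qed.

Lemma is_dC_mult (F G : R -> C) (t : R) (l m : C) :
  is_dC F t l -> is_dC G t m ->
  is_dC (fun s => (F s * G s)%C) t (l * G t + F t * m)%C.
Proof.
  intros [F1 F2] [G1 G2]; split; simpl.
  - eapply is_derive_eq.
    + exact (is_derive_minus _ _ _ _ _ (is_derive_Rmult _ _ _ _ _ F1 G1)
               (is_derive_Rmult _ _ _ _ _ F2 G2)).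
    + unfold minus, plus, opp; simpl; unfold Re, Im; ring.
  - eapply is_derive_eq.
    + exact (is_derive_plus _ _ _ _ _ (is_derive_Rmult _ _ _ _ _ F1 G2)
               (is_derive_Rmult _ _ _ _ _ F2 G1)).
    + unfold minus, plus, opp; simpl; unfold Re, Im; ring.
Qed.

Lemma is_dC_conj (F : R -> C) (t : R) (l : C) :
  is_dC F t l -> is_dC (fun s => Cconj (F s)) t (Cconj l).
Proof.
  intros [F1 F2]; split; simpl.
  - exact F1.
  - exact (is_derive_opp _ _ _ F2).
Qed.

Lemma is_dC_Cexp (F : R -> C) (t : R) (l : C) :
  is_dC F t l -> is_dC (fun s => Cexp (F s)) t (Cexp (F t) * l)%C.
Proof.
  intros [F1 F2]; split; simpl.
  - eapply is_derive_eq.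
    + apply is_derive_Rmult.
      * apply (is_derive_comp exp); [apply is_derive_exp | exact F1].
      * apply (is_derive_comp cos); [apply is_derive_cos | exact F2].
    + unfold scal; simpl; unfold mult; simpl; unfold Re, Im; simpl; ring.
  - eapply is_derive_eq.
    + apply is_derive_Rmult.
      * apply (is_derive_comp exp); [apply is_derive_exp | exact F1].
      * apply (is_derive_comp sin); [apply is_derive_sin | exact F2].
    + unfold scal; simpl; unfold mult; simpl; unfold Re, Im; simpl; ring.
Qed.

Lemma is_dC_RtoC (r : R -> R) (t d : R) :
  is_derive r t d -> is_dC (fun s => RtoC (r s)) t (RtoC d).
Proof. intros H; split; simpl; [exact H | apply @is_derive_const]. Qed.

Lemma is_dC_eq (F : R -> C) (t : R) (l m : C) :
  is_dC F t l -> l = m -> is_dC F t m.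
Proof. intros H <-; exact H. Qed.

Lemma is_dC_ext_loc (F G : R -> C) (t : R) (l : C) :
  locally t (fun s => F s = G s) -> is_dC F t l -> is_dC G t l.
Proof.
  intros E [F1 F2]; split; (eapply is_derive_ext_loc; [|eassumption]);
  revert E; apply filter_imp; intros s ->; reflexivity.
Qed.

Lemma is_dC_unique (F : R -> C) (t : R) (l m : C) :
  is_dC F t l -> is_dC F t m -> l = m.
Proof.
  intros [F1 F2] [G1 G2]; apply C_ext.
  - rewrite <- (is_derive_unique _ _ _ F1); exact (is_derive_unique _ _ _ G1).
  - rewrite <- (is_derive_unique _ _ _ F2); exact (is_derive_unique _ _ _ G2).
Qed.

Lemma partials_const (k : C) z : partials (fun _ => k) z 0 0.
Proof. split; apply is_dC_const. Qed.

Lemma partials_plus f h z l1 l2 m1 m2 :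
  partials f z l1 l2 -> partials h z m1 m2 ->
  partials (fun w => (f w + h w)%C) z (l1 + m1)%C (l2 + m2)%C.
Proof. intros [] []; split; apply is_dC_plus; assumption. Qed.

Lemma partials_mult f h z l1 l2 m1 m2 :
  partials f z l1 l2 -> partials h z m1 m2 ->
  partials (fun w => (f w * h w)%C) z
    (l1 * h z + f z * m1)%C (l2 * h z + f z * m2)%C.
Proof.
  destruct z as [x y].
  intros [f1 f2] [h1 h2]; split;
    [exact (is_dC_mult _ _ _ _ _ f1 h1) | exact (is_dC_mult _ _ _ _ _ f2 h2)].
Qed.

Lemma partials_scal (k : C) f z l1 l2 :
  partials f z l1 l2 ->
  partials (fun w => (k * f w)%C) z (k * l1)%C (k * l2)%C.
Proof.
  intros Hf; pose proof (partials_mult _ _ _ _ _ _ _ (partials_const k z) Hf)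
    as [H1 H2].
  split; (eapply is_dC_eq; [eassumption|ring]).
Qed.

Lemma partials_conj f z l1 l2 :
  partials f z l1 l2 ->
  partials (fun w => Cconj (f w)) z (Cconj l1) (Cconj l2).
Proof.
  intros [f1 f2]; split;
    [exact (is_dC_conj _ _ _ f1) | exact (is_dC_conj _ _ _ f2)].
Qed.

Lemma partials_Cexp f z l1 l2 :
  partials f z l1 l2 ->
  partials (fun w => Cexp (f w)) z (Cexp (f z) * l1)%C (Cexp (f z) * l2)%C.
Proof.
  destruct z as [x y]; intros [f1 f2]; split;
    [exact (is_dC_Cexp _ _ _ f1) | exact (is_dC_Cexp _ _ _ f2)].
Qed.

Lemma partials_fst (r : R -> R) z d :
  is_derive r (fst z) d -> partials (fun w => RtoC (r (fst w))) z (RtoC d) 0.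
Proof.
  intros H; split; simpl; [apply is_dC_RtoC, H | apply is_dC_const].
Qed.

Lemma partials_snd (r : R -> R) z d :
  is_derive r (snd z) d -> partials (fun w => RtoC (r (snd w))) z 0 (RtoC d).
Proof.
  intros H; split; simpl; [apply is_dC_const | apply is_dC_RtoC, H].
Qed.

Lemma partials_eq f z l1 l2 m1 m2 :
  partials f z l1 l2 -> l1 = m1 -> l2 = m2 -> partials f z m1 m2.
Proof. intros H <- <-; exact H. Qed.

(** The derivatives are taken along horizontal and vertical lines, so an
    identity valid on an open set has to be restricted to both lines through the
    point before it can be differentiated. *)
Lemma open_slices (U : R * R -> Prop) z :
  open U -> U z ->
  locally (fst z) (fun t => U (t, snd z)) /\
  locally (snd z) (fun t => U (fst z, t)).
Proof.
  intros HU Hz; destruct z as [x y]; destruct (HU _ Hz) as [e He]; simpl.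
  split; exists e; intros t Ht; apply He; split; simpl;
    auto using ball_center.
Qed.

Lemma partials_ext_on (U : R * R -> Prop) f h z l1 l2 :
  open U -> U z -> (forall w, U w -> f w = h w) ->
  partials f z l1 l2 -> partials h z l1 l2.
Proof.
  intros HU Hz E [f1 f2].
  destruct (open_slices U z HU Hz) as [S1 S2].
  split; (eapply is_dC_ext_loc; [|eassumption]);
    [revert S1 | revert S2]; apply filter_imp; intros t Ht; apply E, Ht.
Qed.

Lemma partials_unique f z l1 l2 m1 m2 :
  partials f z l1 l2 -> partials f z m1 m2 -> l1 = m1 /\ l2 = m2.
Proof.
  intros [] []; split; eapply is_dC_unique; eassumption.
Qed.

Lemma partials_D1 f z l1 l2 : partials f z l1 l2 -> D1 f z = l1.
Proof.
  intros [[f1 f2] _]; apply C_ext;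
    [exact (is_derive_unique _ _ _ f1) | exact (is_derive_unique _ _ _ f2)].
Qed.

Lemma partials_D2 f z l1 l2 : partials f z l1 l2 -> D2 f z = l2.
Proof.
  intros [_ [f1 f2]]; apply C_ext;
    [exact (is_derive_unique _ _ _ f1) | exact (is_derive_unique _ _ _ f2)].
Qed.

Lemma partials_ex f z l1 l2 : partials f z l1 l2 -> ex_D1 f z /\ ex_D2 f z.
Proof.
  intros [[f1 f2] [f3 f4]].
  split; split; eexists; eassumption.
Qed.

Lemma ex_partials f z : ex_D1 f z -> ex_D2 f z -> partials f z (D1 f z) (D2 f z).
Proof.
  intros [f1 f2] [f3 f4].
  split; split; apply Derive_correct; assumption.
Qed.

(** * The complex exponential *)

Lemma Cexp_plus x y : Cexp (x + y) = (Cexp x * Cexp y)%C.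
Proof.
  unfold Cexp; apply C_ext; simpl;
    rewrite exp_plus, ?cos_plus, ?sin_plus; unfold Re, Im; simpl; ring.
Qed.

Lemma Cexp_0 : Cexp 0 = 1%C.
Proof.
  unfold Cexp; apply C_ext; simpl; rewrite exp_0, ?cos_0, ?sin_0; ring.
Qed.

Lemma Cexp_opp x : (Cexp x * Cexp (- x))%C = 1%C.
Proof. rewrite <- Cexp_plus, Cplus_opp_r; apply Cexp_0. Qed.

Lemma Cexp_neq_0 x : Cexp x <> 0%C.
Proof.
  intros H; pose proof (Cexp_opp x) as E; rewrite H in E.
  injection E; lra.
Qed.

Lemma Cexp_conj x : Cconj (Cexp x) = Cexp (Cconj x).
Proof.
  unfold Cexp; apply C_ext; simpl; unfold Re, Im; simpl;
    rewrite ?cos_neg, ?sin_neg; ring.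
Qed.

Lemma Cexp_RtoC r : Cexp (RtoC r) = RtoC (exp r).
Proof. unfold Cexp; apply C_ext; simpl; rewrite ?cos_0, ?sin_0; ring. Qed.

Lemma RtoC_conj r : Cconj (RtoC r) = RtoC r.
Proof. apply C_ext; simpl; ring. Qed.

Lemma Ci_conj : Cconj Ci = (- Ci)%C.
Proof. apply C_ext; simpl; ring. Qed.

Lemma Ci_square : (Ci * Ci)%C = (-1)%C.
Proof. apply C_ext; simpl; ring. Qed.

(** * Derivatives of the powers of a branch *)

Definition phi (n : nat) (a c : R) (z : R * R) : R := c * (fst z - a) ^ n.

(** The derivative of [phi] in [y1]; for [n = 0] the factor [INR n] makes the
    truncated exponent harmless. *)
Definition dphi (n : nat) (a c : R) (z : R * R) : R :=
  c * (INR n * (fst z - a) ^ (n - 1)).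

(** Near a point where [lg] is a logarithm of [g], these are [1/g] and [1/h].
    Writing them as exponentials keeps division out of all the computations:
    only [g * ginv = 1] and [h * hinv = 1] are ever needed. *)
Definition ginv (lg : R * R -> C) (z : R * R) : C := Cexp (- lg z).
Definition hinv (lg : R * R -> C) (z : R * R) : C := Cexp (- Cconj (lg z)).

Definition ghpow (lg : R * R -> C) (s t : R) (z : R * R) : C :=
  (gpow lg s z * hpow lg t z)%C.

Lemma log_branch_near_move n a b c z w U lg :
  log_branch_near n a b c z U lg -> U w -> log_branch_near n a b c w U lg.
Proof. intros (HU & _ & Hs & He) Hw; repeat split; assumption. Qed.

Lemma partials_phi n a c z :
  partials (fun w => RtoC (phi n a c w)) z (RtoC (dphi n a c z)) 0.
Proof.
  destruct z as [x y]; unfold phi, dphi.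
  apply (partials_fst (fun t => c * (t - a) ^ n)).
  auto_derive; trivial.
  replace (n - 1)%nat with (pred n) by lia.
  unfold Rminus; simpl; ring.
Qed.

Lemma partials_g n a b c z :
  partials (g n a b c) z (RtoC ((INR n + 1) * phi n a c z))
    (Ci * RtoC (INR n + 1))%C.
Proof.
  destruct z as [x y]; unfold g, phi.
  assert (P1 : is_derive (fun t => c * (t - a) ^ (n + 1)) x
                 ((INR n + 1) * (c * (x - a) ^ n))).
  { auto_derive; trivial.
    rewrite Nat.add_1_r, S_INR; simpl; unfold Rminus; ring. }
  assert (P2 : is_derive (fun t => (INR n + 1) * (t - b)) y (INR n + 1)).
  { auto_derive; trivial. ring. }
  eapply partials_eq;
    [exact (partials_plus _ _ _ _ _ _ _ (partials_fst _ (x, y) _ P1)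
       (partials_scal Ci _ _ _ _ (partials_snd _ (x, y) _ P2)))| |];
    simpl fst; ring.
Qed.

(** A branch is only known to be differentiable; its derivatives come from
    differentiating [Cexp lg = g] and dividing by [g]. *)
Lemma partials_log n a b c z U lg :
  log_branch_near n a b c z U lg ->
  partials lg z (RtoC (INR n + 1) * RtoC (phi n a c z) * ginv lg z)%C
    (Ci * RtoC (INR n + 1) * ginv lg z)%C.
Proof.
  intros (HU & Hz & Hs & He).
  destruct (proj1 (Hs 1%nat) z Hz) as [e1 e2].
  pose proof (ex_partials _ _ e1 e2) as Hlg.
  pose proof (partials_ext_on U _ _ z _ _ HU Hz He (partials_Cexp _ _ _ _ Hlg))
    as Hg.
  destruct (partials_unique _ _ _ _ _ _ Hg (partials_g n a b c z)) as [E1 E2].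
  rewrite RtoC_mult in E1.
  pose proof (Cexp_opp (lg z)) as Hq.
  eapply partials_eq; [exact Hlg| |]; unfold ginv.
  - rewrite <- E1.
    transitivity (D1 lg z * (Cexp (lg z) * Cexp (- lg z)))%C;
      [rewrite Hq|]; ring.
  - rewrite <- E2.
    transitivity (D2 lg z * (Cexp (lg z) * Cexp (- lg z)))%C;
      [rewrite Hq|]; ring.
Qed.

Lemma ginv_conj lg z : Cconj (ginv lg z) = hinv lg z.
Proof. unfold ginv, hinv; rewrite Cexp_conj, Copp_conj; reflexivity. Qed.

Lemma hinv_conj lg z : Cconj (hinv lg z) = ginv lg z.
Proof. rewrite <- ginv_conj; apply Cconj_conj. Qed.

Lemma partials_log_conj n a b c z U lg :
  log_branch_near n a b c z U lg ->
  partials (fun w => Cconj (lg w)) z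
    (RtoC (INR n + 1) * RtoC (phi n a c z) * hinv lg z)%C
    (- Ci * RtoC (INR n + 1) * hinv lg z)%C.
Proof.
  intros H.
  eapply partials_eq; [exact (partials_conj _ _ _ _ (partials_log _ _ _ _ _ _ _ H))| |];
    rewrite ?Cmult_conj, ?RtoC_conj, ?Ci_conj, ginv_conj; reflexivity.
Qed.

Lemma partials_ginv_of_log lg z l1 l2 :
  partials lg z l1 l2 ->
  partials (ginv lg) z (- (l1 * ginv lg z))%C (- (l2 * ginv lg z))%C.
Proof.
  intros H.
  pose proof (partials_Cexp _ _ _ _ (partials_scal (-1)%C _ _ _ _ H)) as P.
  eapply (partials_ext_on (fun _ => True)); [apply open_true | exact I | |
    eapply partials_eq; [exact P| |]];
    intros; unfold ginv; cbv beta;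
    [f_equal; ring | |]; replace (-1 * lg z)%C with (- lg z)%C by ring; ring.
Qed.

Lemma partials_ginv n a b c z U lg :
  log_branch_near n a b c z U lg ->
  partials (ginv lg) z
    (- (RtoC (INR n + 1) * RtoC (phi n a c z) * (ginv lg z * ginv lg z)))%C
    (- (Ci * RtoC (INR n + 1) * (ginv lg z * ginv lg z)))%C.
Proof.
  intros H; eapply partials_eq;
    [exact (partials_ginv_of_log _ _ _ _ (partials_log _ _ _ _ _ _ _ H))| |]; ring.
Qed.

Lemma partials_hinv n a b c z U lg :
  log_branch_near n a b c z U lg ->
  partials (hinv lg) z
    (- (RtoC (INR n + 1) * RtoC (phi n a c z) * (hinv lg z * hinv lg z)))%C
    (Ci * RtoC (INR n + 1) * (hinv lg z * hinv lg z))%C.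
Proof.
  intros H.
  eapply (partials_ext_on U); [apply H | apply H | |
    eapply partials_eq;
      [exact (partials_conj _ _ _ _ (partials_ginv _ _ _ _ _ _ _ H))| |]].
  - intros w _; apply ginv_conj.
  - rewrite Copp_conj, !Cmult_conj, !RtoC_conj, ginv_conj; reflexivity.
  - rewrite Copp_conj, !Cmult_conj, !RtoC_conj, Ci_conj, ginv_conj; ring.
Qed.

Lemma partials_gpow n a b c z U lg (s : R) :
  log_branch_near n a b c z U lg ->
  partials (gpow lg s) z
    (gpow lg s z * (RtoC s * (RtoC (INR n + 1) * RtoC (phi n a c z) * ginv lg z)))%C
    (gpow lg s z * (RtoC s * (Ci * RtoC (INR n + 1) * ginv lg z)))%C.
Proof.
  intros H; exact (partials_Cexp _ _ _ _ (partials_scal _ _ _ _ _ (partials_log _ _ _ _ _ _ _ H))).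
Qed.

Lemma partials_hpow n a b c z U lg (s : R) :
  log_branch_near n a b c z U lg ->
  partials (hpow lg s) z
    (hpow lg s z * (RtoC s * (RtoC (INR n + 1) * RtoC (phi n a c z) * hinv lg z)))%C
    (hpow lg s z * (RtoC s * (- Ci * RtoC (INR n + 1) * hinv lg z)))%C.
Proof.
  intros H; exact (partials_Cexp _ _ _ _ (partials_scal _ _ _ _ _ (partials_log_conj _ _ _ _ _ _ _ H))).
Qed.

(** [D2_ghpow] is the plain derivative in [y2], without the coefficient [phi]
    that turns it into [Y2]; the bracket needs it in this form. *)
Definition D1_ghpow n a c lg (s t : R) (z : R * R) : C :=
  (RtoC (INR n + 1) * RtoC (phi n a c z) * (ghpow lg s t z *
     (RtoC s * ginv lg z + RtoC t * hinv lg z)))%C.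

Definition D2_ghpow (n : nat) lg (s t : R) (z : R * R) : C :=
  (Ci * RtoC (INR n + 1) * (ghpow lg s t z *
     (RtoC s * ginv lg z + - RtoC t * hinv lg z)))%C.

Lemma partials_ghpow n a b c z U lg (s t : R) :
  log_branch_near n a b c z U lg ->
  partials (ghpow lg s t) z (D1_ghpow n a c lg s t z) (D2_ghpow n lg s t z).
Proof.
  intros H; unfold D1_ghpow, D2_ghpow; eapply partials_eq;
    [exact (partials_mult _ _ _ _ _ _ _ (partials_gpow _ _ _ _ _ _ _ s H)
              (partials_hpow _ _ _ _ _ _ _ t H))| |]; unfold ghpow; ring.
Qed.

(** Both [Y1] and [Y2] of [ghpow lg s t] have, up to an explicit factor, the
    shape below, with [t' = t] and [t' = - t] respectively; this is what the
    second derivatives reduce to. *)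
Lemma partials_ghpow_factor n a b c z U lg (s t s' t' : R) :
  log_branch_near n a b c z U lg ->
  partials (fun w => ghpow lg s t w * (RtoC s' * ginv lg w + RtoC t' * hinv lg w))%C z
    (RtoC (INR n + 1) * RtoC (phi n a c z) * ghpow lg s t z *
      ((RtoC s * ginv lg z + RtoC t * hinv lg z)
       * (RtoC s' * ginv lg z + RtoC t' * hinv lg z)
       - (RtoC s' * (ginv lg z * ginv lg z) + RtoC t' * (hinv lg z * hinv lg z))))%C
    (Ci * RtoC (INR n + 1) * ghpow lg s t z *
      ((RtoC s * ginv lg z - RtoC t * hinv lg z)
       * (RtoC s' * ginv lg z + RtoC t' * hinv lg z)
       - (RtoC s' * (ginv lg z * ginv lg z) - RtoC t' * (hinv lg z * hinv lg z))))%C.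
Proof.
  intros H; eapply partials_eq;
    [exact (partials_mult _ _ _ _ _ _ _ (partials_ghpow _ _ _ _ _ _ _ s t H)
       (partials_plus _ _ _ _ _ _ _
         (partials_scal (RtoC s') _ _ _ _ (partials_ginv _ _ _ _ _ _ _ H))
         (partials_scal (RtoC t') _ _ _ _ (partials_hinv _ _ _ _ _ _ _ H))))| |];
   unfold D1_ghpow, D2_ghpow; ring.
Qed.

Lemma Y1_ghpow n a b c z U lg (s t : R) :
  log_branch_near n a b c z U lg ->
  Y1 (ghpow lg s t) z = D1_ghpow n a c lg s t z.
Proof.
  intros H; exact (partials_D1 _ _ _ _ (partials_ghpow _ _ _ _ _ _ _ s t H)).
Qed.

Lemma Y2_ghpow n a b c z U lg (s t : R) :
  log_branch_near n a b c z U lg ->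
  Y2 n a c (ghpow lg s t) z = (RtoC (phi n a c z) * D2_ghpow n lg s t z)%C.
Proof.
  intros H; unfold Y2.
  rewrite (partials_D2 _ _ _ _ (partials_ghpow _ _ _ _ _ _ _ s t H)).
  reflexivity.
Qed.

Lemma partials_Y1_ghpow n a b c z U lg (s t : R) :
  log_branch_near n a b c z U lg ->
  partials (Y1 (ghpow lg s t)) z
    (RtoC (INR n + 1) * ghpow lg s t z *
      (RtoC (dphi n a c z) * (RtoC s * ginv lg z + RtoC t * hinv lg z)
       + RtoC (INR n + 1) * (RtoC (phi n a c z) * RtoC (phi n a c z))
         * ((RtoC s * ginv lg z + RtoC t * hinv lg z)
            * (RtoC s * ginv lg z + RtoC t * hinv lg z)
            - (RtoC s * (ginv lg z * ginv lg z) + RtoC t * (hinv lg z * hinv lg z)))))%C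
    (Ci * RtoC (INR n + 1) * RtoC (INR n + 1) * RtoC (phi n a c z) * ghpow lg s t z *
      ((RtoC s * ginv lg z - RtoC t * hinv lg z)
       * (RtoC s * ginv lg z + RtoC t * hinv lg z)
       - (RtoC s * (ginv lg z * ginv lg z) - RtoC t * (hinv lg z * hinv lg z))))%C.
Proof.
  intros H.
  eapply (partials_ext_on U); [apply H | apply H | |].
  - intros w Hw; symmetry; eapply Y1_ghpow, log_branch_near_move; eassumption.
  - unfold D1_ghpow; eapply partials_eq;
    [exact (partials_mult _ _ _ _ _ _ _ (partials_scal _ _ _ _ _ (partials_phi n a c z))
         (partials_ghpow_factor _ _ _ _ _ _ _ s t s t H))| |]; cbv beta; ring.
Qed.

Lemma partials_Y2_ghpow n a b c z U lg (s t : R) :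
  log_branch_near n a b c z U lg ->
  partials (Y2 n a c (ghpow lg s t)) z
    (Ci * RtoC (INR n + 1) * ghpow lg s t z *
      (RtoC (dphi n a c z) * (RtoC s * ginv lg z - RtoC t * hinv lg z)
       + RtoC (INR n + 1) * (RtoC (phi n a c z) * RtoC (phi n a c z))
         * ((RtoC s * ginv lg z + RtoC t * hinv lg z)
            * (RtoC s * ginv lg z - RtoC t * hinv lg z)
            - (RtoC s * (ginv lg z * ginv lg z) - RtoC t * (hinv lg z * hinv lg z)))))%C
    (- (RtoC (INR n + 1) * RtoC (INR n + 1) * RtoC (phi n a c z) * ghpow lg s t z *
      ((RtoC s * ginv lg z - RtoC t * hinv lg z)
       * (RtoC s * ginv lg z - RtoC t * hinv lg z)
       - (RtoC s * (ginv lg z * ginv lg z) + RtoC t * (hinv lg z * hinv lg z)))))%C.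
Proof.
  intros H.
  eapply (partials_ext_on U); [apply H | apply H | |].
  - intros w Hw; symmetry; eapply Y2_ghpow, log_branch_near_move; eassumption.
  - unfold D2_ghpow.
    pose proof (partials_ghpow_factor _ _ _ _ _ _ _ s t s (- t) H) as P.
    rewrite RtoC_opp in P.
    eapply partials_eq;
    [exact (partials_mult _ _ _ _ _ _ _ (partials_phi n a c z)
         (partials_scal _ _ _ _ _ P))| |]; cbv beta; [ring | ring [Ci_square]].
Qed.

(** The second derivatives of [f] cancel, and only the derivative of the
    coefficient of [Y2] is left. *)
Lemma bracket_ghpow n a b c z U lg (s t : R) :
  log_branch_near n a b c z U lg ->
  bracket n a c (ghpow lg s t) z
  = (RtoC (dphi n a c z) * D2_ghpow n lg s t z)%C.
Proof.
  intros H; unfold bracket.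
  unfold Y1 at 1; rewrite (partials_D1 _ _ _ _ (partials_Y2_ghpow _ _ _ _ _ _ _ s t H)).
  unfold Y2; rewrite (partials_D2 _ _ _ _ (partials_Y1_ghpow _ _ _ _ _ _ _ s t H)).
  change (c * (fst z - a) ^ n) with (phi n a c z).
  unfold D2_ghpow; ring.
Qed.

(** Parallelogram law: as [hinv] is the conjugate of [ginv], the squared moduli
    of [s q + t r] and [s q - t r] add up to [2 (s^2 + t^2) |q|^2]. *)
Lemma grad_norm_ghpow n a b c z U lg (s t : R) :
  log_branch_near n a b c z U lg ->
  grad_norm n a c (ghpow lg s t) z
  = sqrt (exp (2 * (s + t - 1) * Re (lg z)) * (2 * (s ^ 2 + t ^ 2))
          * ((INR n + 1) * phi n a c z) ^ 2).
Proof.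
  intros H; unfold grad_norm.
  rewrite (Y1_ghpow _ _ _ _ _ _ _ s t H), (Y2_ghpow _ _ _ _ _ _ _ s t H).
  unfold D1_ghpow, D2_ghpow.
  assert (E : (ghpow lg s t z * Cconj (ghpow lg s t z) * (ginv lg z * hinv lg z))%C
              = RtoC (exp (2 * (s + t - 1) * Re (lg z)))).
  { unfold ghpow, gpow, hpow, ginv, hinv.
    rewrite Cmult_conj, !Cexp_conj, !Cmult_conj, !RtoC_conj, Cconj_conj.
    rewrite <- !Cexp_plus, <- Cexp_RtoC.
    f_equal; apply C_ext; simpl; unfold Re, Im; simpl; ring. }
  f_equal.
  match goal with |- Re ?X = ?Y => assert (EE : X = RtoC Y); [|rewrite EE; reflexivity] end.
  rewrite !RtoC_mult, <- E.
  rewrite !Cmult_conj, !Cplus_conj, !Cmult_conj, !Copp_conj, !RtoC_conj, ginv_conj, hinv_conj,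
   Ci_conj.
  rewrite !RtoC_plus, !RtoC_pow, !RtoC_mult, ?RtoC_plus.
  ring [Ci_square].
Qed.

(** * The weight away from the degenerate line *)

Lemma phi_neq_0 n a c z : c <> 0 -> fst z <> a -> phi n a c z <> 0.
Proof.
  intros Hc Hz; unfold phi; apply Rmult_integral_contrapositive_currified;
    [exact Hc | apply pow_nonzero; lra].
Qed.

Lemma open_off_axis (a : R) : open (fun w : R * R => fst w <> a).
Proof.
  apply (open_comp (fun w : R * R => fst w) (fun x => x <> a)).
  - intros [x y] _; apply continuous_fst.
  - apply open_neq.
Qed.

Lemma ln_sqrt x : 0 < x -> ln (sqrt x) = ln x / 2.
Proof.
  intros Hx; rewrite <- Rpower_sqrt by exact Hx.
  unfold Rpower; rewrite ln_exp; field.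
Qed.

(** [lg + Cconj lg] is [2 Re lg], so the weight is the exponential of a real
    function that the rules for [partials] can differentiate. *)
Lemma weight_ghpow n a b c z U lg (p s t : R) :
  log_branch_near n a b c z U lg ->
  0 < s ^ 2 + t ^ 2 -> phi n a c z <> 0 ->
  weight p n a c (ghpow lg s t) z
  = Cexp (RtoC ((p - 2) / 2 * (s + t - 1)) * (lg z + Cconj (lg z))
          + RtoC ((p - 2) / 2
                  * ln (2 * (s ^ 2 + t ^ 2) * ((INR n + 1) * phi n a c z) ^ 2))).
Proof.
  intros H Hst Hphi; unfold weight.
  assert (Hm : 0 < ((INR n + 1) * phi n a c z) ^ 2).
  { apply pow2_gt_0, Rmult_integral_contrapositive_currified; [|exact Hphi].
    pose proof (pos_INR n); lra. }
  assert (HN : 0 < 2 * (s ^ 2 + t ^ 2) * ((INR n + 1) * phi n a c z) ^ 2)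
    by (apply Rmult_lt_0_compat; lra).
  rewrite (grad_norm_ghpow _ _ _ _ _ _ _ s t H), Rmult_assoc.
  set (N := 2 * (s ^ 2 + t ^ 2) * ((INR n + 1) * phi n a c z) ^ 2) in *.
  assert (Hp := exp_pos (2 * (s + t - 1) * Re (lg z))).
  assert (HeN := Rmult_lt_0_compat _ _ Hp HN).
  unfold rpow; destruct (Req_EM_T _ 0) as [E|_].
  { pose proof (sqrt_lt_R0 _ HeN); lra. }
  unfold Rpower; rewrite ln_sqrt, ln_mult, ln_exp by assumption.
  rewrite <- Cexp_RtoC; f_equal; apply C_ext; simpl; unfold Re, Im; simpl;
    [field | ring].
Qed.

Lemma partials_weight_off_axis n a b c z U lg (p s t : R) :
  log_branch_near n a b c z U lg ->
  0 < s ^ 2 + t ^ 2 -> c <> 0 -> fst z <> a ->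
  partials (weight p n a c (ghpow lg s t)) z
    (weight p n a c (ghpow lg s t) z * (RtoC (p - 2) *
      (RtoC ((s + t - 1) / 2) * (RtoC (INR n + 1) * RtoC (phi n a c z)
         * (ginv lg z + hinv lg z))
       + RtoC (dphi n a c z / phi n a c z))))%C
    (weight p n a c (ghpow lg s t) z * (RtoC (p - 2) *
      (RtoC ((s + t - 1) / 2) * (Ci * RtoC (INR n + 1)
         * (ginv lg z - hinv lg z)))))%C.
Proof.
  intros H Hst Hc Hz.
  apply (partials_ext_on (fun w => U w /\ fst w <> a))
    with (f := fun w => Cexp (RtoC ((p - 2) / 2 * (s + t - 1)) * (lg w + Cconj (lg w))
          + RtoC ((p - 2) / 2
                  * ln (2 * (s ^ 2 + t ^ 2) * ((INR n + 1) * phi n a c w) ^ 2)))).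
  - apply open_and; [apply H | apply open_off_axis].
  - split; [apply H | exact Hz].
  - intros w [Hw Hwa]; symmetry; eapply weight_ghpow;
      [eapply log_branch_near_move; eassumption | exact Hst
      | apply phi_neq_0; assumption].
  - rewrite (weight_ghpow _ _ _ _ _ _ _ p s t H Hst (phi_neq_0 n a c z Hc Hz)).
    assert (Hd : is_derive (fun x => (p - 2) / 2
                  * ln (2 * (s ^ 2 + t ^ 2) * ((INR n + 1) * (c * (x - a) ^ n)) ^ 2))
                 (fst z) ((p - 2) * (dphi n a c z / phi n a c z))).
    { pose proof (phi_neq_0 n a c z Hc Hz) as Hphi.
      pose proof (pos_INR n) as Hn.
      destruct z as [x y]; unfold phi, dphi in *; simpl fst in *.
      replace (n - 1)%nat with (pred n) by lia.
      assert (Hpow : (x - a) ^ n <> 0) by (apply pow_nonzero; lra).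
      auto_derive.
      - apply Rmult_lt_0_compat; [simpl in *; lra|].
        apply pow2_gt_0, Rmult_integral_contrapositive_currified;
          [lra | exact Hphi].
      - change (x + - a) with (x - a); field; repeat split; try assumption; simpl in *; lra. }
    pose proof (partials_log _ _ _ _ _ _ _ H) as P1.
    pose proof (partials_log_conj _ _ _ _ _ _ _ H) as P2.
    eapply partials_eq;
      [exact (partials_Cexp _ _ _ _ (partials_plus _ _ _ _ _ _ _
        (partials_scal _ _ _ _ _ (partials_plus _ _ _ _ _ _ _ P1 P2))
        (partials_fst _ z _ Hd)))| |]; cbv beta; f_equal.
    + replace ((p - 2) / 2 * (s + t - 1)) with ((p - 2) * ((s + t - 1) / 2)) by field.
      rewrite !RtoC_mult; ring.
    + replace ((p - 2) / 2 * (s + t - 1)) with ((p - 2) * ((s + t - 1) / 2)) by field.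
      rewrite !RtoC_mult; ring.
Qed.

Lemma weight_two n a c f z : weight 2 n a c f z = RtoC 1.
Proof.
  unfold weight, rpow; replace (2 - 2) with 0 by ring.
  destruct (Req_EM_T _ 0) as [_|Hg].
  - destruct (Req_EM_T 0 0); congruence.
  - unfold Rpower; rewrite Rmult_0_l, exp_0; reflexivity.
Qed.

(** For [p = 2] the weight is constant and its logarithmic derivatives are [0],
    on the degenerate line too.  Multiplied by [phi], the logarithmic derivatives
    have a form without division by [phi], which covers both cases at once. *)
Lemma partials_weight n a b c z U lg (p s t : R) :
  log_branch_near n a b c z U lg ->
  0 < s ^ 2 + t ^ 2 -> c <> 0 -> fst z <> a \/ p = 2 ->
  exists w1 w2 : C,
    partials (weight p n a c (ghpow lg s t)) z
      (weight p n a c (ghpow lg s t) z * w1)%C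
      (weight p n a c (ghpow lg s t) z * w2)%C /\
    (RtoC (phi n a c z) * w1)%C
    = (RtoC (p - 2) * (RtoC ((s + t - 1) / 2) *
         (RtoC (INR n + 1) * (RtoC (phi n a c z) * RtoC (phi n a c z))
          * (ginv lg z + hinv lg z)) + RtoC (dphi n a c z)))%C /\
    (RtoC (phi n a c z) * w2)%C
    = (RtoC (p - 2) * (RtoC ((s + t - 1) / 2) *
         (Ci * RtoC (INR n + 1) * RtoC (phi n a c z)
          * (ginv lg z - hinv lg z))))%C.
Proof.
  intros H Hst Hc [Hz| ->].
  - eexists; eexists; split;
      [exact (partials_weight_off_axis _ _ _ _ _ _ _ p s t H Hst Hc Hz)|].
    assert (Hphi : RtoC (phi n a c z) <> 0%C).
    { intros E; injection E; apply phi_neq_0; assumption. }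
    split; [|ring].
    unfold Rdiv at 2; rewrite (RtoC_mult (dphi n a c z)), RtoC_inv
      by (apply phi_neq_0; assumption).
    field; exact Hphi.
  - exists 0%C, 0%C; split; [|replace (2 - 2) with 0 by ring; split; ring].
    apply (partials_ext_on U) with (f := fun _ => RtoC 1); try apply H.
    + intros w _; symmetry; apply weight_two.
    + rewrite weight_two; eapply partials_eq; [apply partials_const| |]; ring.
Qed.

(** Here the geometry enters: [q + r = (g + h) q r], where
    [g + h = 2 c (y1 - a)^(n+1)] and [(y1 - a) dphi = n phi]. *)
Lemma dphi_ginv n a b c z U lg :
  (1 <= n)%nat -> log_branch_near n a b c z U lg ->
  (RtoC (dphi n a c z) * (ginv lg z + hinv lg z))%C
  = (RtoC (2 * INR n) * (RtoC (phi n a c z) * RtoC (phi n a c z))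
     * (ginv lg z * hinv lg z))%C.
Proof.
  intros Hn H.
  pose proof (Cexp_opp (lg z)) as Hq.
  pose proof (f_equal Cconj Hq) as Hr.
  rewrite Cmult_conj, RtoC_conj in Hr.
  change (Cexp (- lg z)) with (ginv lg z) in *.
  rewrite ginv_conj in Hr.
  destruct H as (_ & Hz & _ & He); rewrite (He z Hz) in Hq, Hr.
  assert (E : (RtoC (dphi n a c z) * (g n a b c z + Cconj (g n a b c z)))%C
              = (RtoC (2 * INR n) * (RtoC (phi n a c z) * RtoC (phi n a c z)))%C).
  { unfold g; rewrite Cplus_conj, Cmult_conj, !RtoC_conj, Ci_conj.
    transitivity (RtoC (dphi n a c z * (2 * (c * (fst z - a) ^ (n + 1)))))%C.
    - rewrite !RtoC_mult; ring.
    - rewrite <- !RtoC_mult; f_equal; unfold dphi, phi.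
      destruct n as [|k]; [lia|].
      replace (S k - 1)%nat with k by lia.
      rewrite Nat.add_1_r; simpl pow; ring. }
  transitivity (RtoC (dphi n a c z) * (ginv lg z * (Cconj (g n a b c z) * hinv lg z)
     + hinv lg z * (g n a b c z * ginv lg z)))%C; [rewrite Hq, Hr; ring|].
  rewrite <- E; ring.
Qed.

(** * The identity at regular points *)

(** The letters stand for the quantities at the point: [W] the weight and
    [W * w1], [W * w2] its derivatives, [q] and [r] the inverses of [g] and [h],
    [P] and [dP] for [phi] and [dphi], and [f] for [g^s h^t].  The hypotheses are
    used from top to bottom: [w1] and [w2] are eliminated, the terms with [dP]
    become a multiple of [dP * (q + r)] through [gm], and this sum turns into a
    multiple of [P^2 q r], like every other term.  The last hypothesis is the
    vanishing of the resulting coefficient. *)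
Lemma p_laplace_algebra (W f q r P dP m n s t p1 p2 L k w1 w2 sg gm : C) :
  (P * w1)%C = (p2 * (sg * (m * (P * P) * (q + r)) + dP))%C ->
  (P * w2)%C = (p2 * (sg * (Ci * m * P * (q - r))))%C ->
  (dP * (q + r))%C = (n * (P * P) * (q * r))%C ->
  p1 = (p2 + 1)%C ->
  (s * (1 - L))%C = gm -> (t * (1 + L))%C = gm ->
  (2 * sg * p2 * (s + t) * m + p1 * gm * n + 4 * s * t * m - k * s * t * m)%C = 0%C ->
  (W * w1 * (m * P * (f * (s * q + t * r)))
   + W * (m * f * (dP * (s * q + t * r)
        + m * (P * P) * ((s * q + t * r) * (s * q + t * r)
                         - (s * (q * q) + t * (r * r)))))
   + P * (W * w2 * (P * (Ci * m * (f * (s * q + - t * r))))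
          + W * - (m * m * P * f * ((s * q - t * r) * (s * q - t * r)
                       - (s * (q * q) + t * (r * r)))))
   + Ci * (L * p1) * W * (dP * (Ci * m * (f * (s * q + - t * r))))
   - W * k * (P * (s * (Ci * m * q))) * (P * (t * (- Ci * m * r))) * f)%C = 0%C.
Proof.
  intros E1 E2 E3 -> Es Et E0.
  transitivity (W * (f * m * (s * q + t * r) * (P * w1)
    + P * f * Ci * m * (s * q - t * r) * (P * w2)
    + (4 * m * m * (P * P) * f * s * t * q * r + f * m * dP * (s * q + t * r)
       - L * (p2 + 1) * dP * f * m * (s * q - t * r)
       - k * s * t * f * (P * P) * m * m * q * r)))%C; [ring [Ci_square]|].
  rewrite E1, E2.
  transitivity (W * f * m * (
     2 * sg * p2 * (s + t) * m * (P * P) * q * r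
     + (p2 + 1) * dP * ((s * (1 - L)) * q + (t * (1 + L)) * r)
     + (4 * s * t * m - k * s * t * m) * (P * P) * q * r))%C; [ring [Ci_square]|].
  rewrite Es, Et.
  transitivity (W * f * m * (
     2 * sg * p2 * (s + t) * m * (P * P) * q * r
     + (p2 + 1) * gm * (dP * (q + r))
     + (4 * s * t * m - k * s * t * m) * (P * P) * q * r))%C; [ring|].
  rewrite E3.
  transitivity (W * f * m * (P * P) * q * r *
    (2 * sg * p2 * (s + t) * m + (p2 + 1) * gm * n + 4 * s * t * m - k * s * t * m))%C;
    [ring|].
  rewrite E0; ring.
Qed.

(** The exponents are chosen so that these two products agree: this is what
    makes the first-order terms of the p-Laplacian and of the bracket
    proportional to [q + r]. *)
Lemma alpha_beta_gamma n p L :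
  alpha n p L * (1 - L)
  = (INR n + 2 - p) / ((1 - p) * (2 * INR n + 2)) * (1 - L ^ 2) /\
  beta n p L * (1 + L)
  = (INR n + 2 - p) / ((1 - p) * (2 * INR n + 2)) * (1 - L ^ 2).
Proof. unfold alpha, beta; split; ring. Qed.

Lemma exponent_balance n p L :
  1 < p -> p <> INR n + 2 -> L <> 1 -> L <> -1 ->
  2 * ((alpha n p L + beta n p L - 1) / 2) * (p - 2)
    * (alpha n p L + beta n p L) * (INR n + 1)
  + (p - 1) * ((INR n + 2 - p) / ((1 - p) * (2 * INR n + 2)) * (1 - L ^ 2))
    * (2 * INR n)
  + 4 * alpha n p L * beta n p L * (INR n + 1)
  - (L ^ 2 / (L ^ 2 - 1) * (-4) * ((p - 2) * (1 + INR n * p) / (2 + INR n - p)))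
    * alpha n p L * beta n p L * (INR n + 1) = 0.
Proof.
  intros Hp Hpn H1 H2; unfold alpha, beta.
  pose proof (pos_INR n).
  field; repeat split; try lra.
  intros E; assert (E' : (L - 1) * (L + 1) = 0) by (simpl in E; lra).
  apply Rmult_integral in E'; lra.
Qed.

Lemma alpha_beta_pos n p L :
  1 < p -> p <> INR n + 2 -> L <> -1 -> 0 < alpha n p L ^ 2 + beta n p L ^ 2.
Proof.
  intros Hp Hpn HL.
  pose proof (pos_INR n).
  assert (Ha : alpha n p L <> 0).
  { unfold alpha, Rdiv; repeat apply Rmult_integral_contrapositive_currified;
      try apply Rinv_neq_0_compat;
      try apply Rmult_integral_contrapositive_currified; lra. }
  pose proof (pow2_gt_0 _ Ha); pose proof (pow2_ge_0 (beta n p L)); lra.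
Qed.

Lemma p_laplace_identity_regular n a b c p L z U lg :
  (1 <= n)%nat -> c <> 0 -> 1 < p -> p <> INR n + 2 -> L <> 1 -> L <> -1 ->
  log_branch_near n a b c z U lg -> fst z <> a \/ p = 2 ->
  plaplacian_defined p n a c (fpL n p L lg) z /\
  (plaplacian p n a c (fpL n p L lg) z
   + Ci * RtoC (L * (p - 1)) * weight p n a c (fpL n p L lg) z
     * bracket n a c (fpL n p L lg) z
   - weight p n a c (fpL n p L lg) z
     * RtoC (L ^ 2 / (L ^ 2 - 1) * (-4)
             * ((p - 2) * (1 + INR n * p) / (2 + INR n - p)))
     * Y2 n a c (gpow lg (alpha n p L)) z
     * Y2 n a c (hpow lg (beta n p L)) z)%C = RtoC 0.
Proof.
  intros Hn Hc Hp Hpn HL1 HL2 H Hz.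
  pose proof (alpha_beta_pos n p L Hp Hpn HL2) as Hst.
  pose proof (exponent_balance n p L Hp Hpn HL1 HL2) as Hcoef.
  destruct (alpha_beta_gamma n p L) as [Hg1 Hg2].
  change (fpL n p L lg) with (ghpow lg (alpha n p L) (beta n p L)).
  set (s := alpha n p L) in *; set (t := beta n p L) in *.
  destruct (partials_weight _ _ _ _ _ _ _ p s t H Hst Hc Hz)
    as (w1 & w2 & HW & Hw1 & Hw2).
  pose proof (partials_mult _ _ _ _ _ _ _ HW (partials_Y1_ghpow _ _ _ _ _ _ _ s t H)) as P1.
  pose proof (partials_mult _ _ _ _ _ _ _ HW (partials_Y2_ghpow _ _ _ _ _ _ _ s t H)) as P2.
  split; [split; [apply (partials_ex _ _ _ _ P1) | apply (partials_ex _ _ _ _ P2)]|].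
  (* Only the outer derivatives are replaced here: they act on products with
     the weight, whose derivatives are in P1 and P2. *)
  unfold plaplacian.
  unfold Y1 at 1; rewrite (partials_D1 _ _ _ _ P1).
  unfold Y2 at 1; rewrite (partials_D2 _ _ _ _ P2).
  rewrite (bracket_ghpow _ _ _ _ _ _ _ s t H).
  rewrite (Y1_ghpow _ _ _ _ _ _ _ s t H), (Y2_ghpow _ _ _ _ _ _ _ s t H).
  unfold Y2.
  rewrite (partials_D2 _ _ _ _ (partials_gpow _ _ _ _ _ _ _ s H)).
  rewrite (partials_D2 _ _ _ _ (partials_hpow _ _ _ _ _ _ _ t H)).
  change (c * (fst z - a) ^ n) with (phi n a c z).
  unfold D1_ghpow, D2_ghpow.
  rewrite (RtoC_mult L (p - 1)).
  rewrite <- (p_laplace_algebra (weight p n a c (ghpow lg s t) z) (ghpow lg s t z)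
    (ginv lg z) (hinv lg z) (RtoC (phi n a c z)) (RtoC (dphi n a c z))
    (RtoC (INR n + 1)) (RtoC (2 * INR n)) (RtoC s) (RtoC t)
    (RtoC (p - 1)) (RtoC (p - 2)) (RtoC L)
    (RtoC (L ^ 2 / (L ^ 2 - 1) * (-4) * ((p - 2) * (1 + INR n * p) / (2 + INR n - p))))
    w1 w2 (RtoC ((s + t - 1) / 2))
    (RtoC ((INR n + 2 - p) / ((1 - p) * (2 * INR n + 2)) * (1 - L ^ 2)))).
  - replace (ghpow lg s t z) with (gpow lg s z * hpow lg t z)%C by reflexivity.
    ring.
  - exact Hw1.
  - exact Hw2.
  - exact (dphi_ginv _ _ _ _ _ _ _ Hn H).
  - rewrite <- RtoC_plus; f_equal; ring.
  - rewrite <- RtoC_minus, <- RtoC_mult; f_equal; exact Hg1.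
  - rewrite <- RtoC_plus, <- RtoC_mult; f_equal; exact Hg2.
  - rewrite <- Hcoef; repeat rewrite ?RtoC_minus, ?RtoC_plus, ?RtoC_mult; ring.
Qed.

(** * The degenerate line for p > 2 *)

Lemma is_derive_factor (h : R -> R) (x : R) :
  continuous h x -> is_derive (fun t => (t - x) * h t) x (h x).
Proof.
  intros Hh; apply is_derive_Reals; intros eps Heps.
  destruct (proj1 (filterlim_locally h (h x)) Hh (mkposreal eps Heps))
    as [d Hd].
  exists d; intros k Hk Hkd.
  replace (((x + k - x) * h (x + k) - (x - x) * h x) / k - h x)
    with (h (x + k) - h x) by (field; exact Hk).
  apply Hd; unfold ball; simpl; unfold AbsRing_ball, abs, minus, plus, opp; simpl.
  replace (x + k + - x) with k by ring; exact Hkd.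
Qed.

(** The weight is merely continuous on the degenerate line, so the product rule
    does not apply; a factor vanishing at the point makes continuity enough. *)
Lemma is_dC_factor (w : R -> R) (k : R -> C) (x : R) (l : C) :
  continuous w x -> w x = 0 -> is_dC k x l ->
  is_dC (fun t => (RtoC ((t - x) * w t) * k t)%C) x 0.
Proof.
  intros Hw Hw0 [k1 k2].
  assert (Hk : forall h : R -> R, ex_derive h x ->
            is_derive (fun t => (t - x) * (w t * h t)) x 0).
  { intros h Hh; eapply is_derive_eq; [apply is_derive_factor|].
    - apply (continuous_mult w h); [exact Hw | exact (ex_derive_continuous h x Hh)].
    - rewrite Hw0; ring. }
  split.
  - eapply is_derive_ext; [|apply (Hk (fun t => Re (k t)));
      eexists; exact k1].
    intros t; simpl; unfold Re, Im; simpl; ring.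
  - eapply is_derive_ext; [|apply (Hk (fun t => Im (k t)));
      eexists; exact k2].
    intros t; simpl; unfold Re, Im; simpl; ring.
Qed.

Lemma rpow_0 s : 0 < s -> rpow 0 s = 0.
Proof.
  intros Hs; unfold rpow; destruct (Req_EM_T 0 0); [|congruence].
  destruct (Req_EM_T s 0); lra.
Qed.

Lemma rpow_small s eps x :
  0 < s -> 0 < eps -> 0 <= x < Rpower eps (/ s) -> Rabs (rpow x s) < eps.
Proof.
  intros Hs He [Hx0 Hx].
  destruct (Req_EM_T x 0) as [->|Hx1].
  - rewrite rpow_0, Rabs_R0 by exact Hs; exact He.
  - unfold rpow; destruct (Req_EM_T x 0); [congruence|].
    rewrite Rabs_pos_eq by (unfold Rpower; left; apply exp_pos).
    replace eps with (Rpower (Rpower eps (/ s)) s).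
    + apply Rlt_Rpower_l; lra.
    + rewrite Rpower_mult, Rinv_l, Rpower_1 by lra; reflexivity.
Qed.

Lemma continuous_rpow_at_zero (h : R -> R) x s :
  0 < s -> (forall t, 0 <= h t) -> h x = 0 -> continuous h x ->
  continuous (fun t => rpow (h t) s) x.
Proof.
  intros Hs Hpos H0 Hh.
  apply (proj2 (filterlim_locally (fun t => rpow (h t) s) (rpow (h x) s))).
  intros eps.
  assert (Hd : 0 < Rpower eps (/ s)) by apply exp_pos.
  generalize (proj1 (filterlim_locally h (h x)) Hh (mkposreal _ Hd)).
  apply filter_imp; intros t Ht.
  rewrite H0 in *; rewrite (rpow_0 s Hs).
  unfold ball in *; simpl in *; unfold AbsRing_ball, abs, minus, plus, opp in *;
    simpl in *.
  rewrite Ropp_0, Rplus_0_r in *.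
  apply rpow_small; [exact Hs | apply cond_pos|].
  split; [apply Hpos|].
  rewrite Rabs_pos_eq in Ht; [exact Ht | apply Hpos].
Qed.

Lemma phi_axis n a c y : (1 <= n)%nat -> phi n a c (a, y) = 0.
Proof.
  intros Hn; unfold phi; simpl fst; rewrite Rminus_diag, pow_i by lia; ring.
Qed.

Lemma grad_norm_axis n a b c y U lg (s t : R) :
  (1 <= n)%nat -> log_branch_near n a b c (a, y) U lg ->
  grad_norm n a c (ghpow lg s t) (a, y) = 0.
Proof.
  intros Hn H; rewrite (grad_norm_ghpow _ _ _ _ _ _ _ s t H), phi_axis by exact Hn.
  transitivity (sqrt 0); [f_equal; ring | apply sqrt_0].
Qed.

Lemma continuous_grad_norm n a b c z U lg (s t : R) :
  log_branch_near n a b c z U lg ->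
  continuous (fun x => grad_norm n a c (ghpow lg s t) (x, snd z)) (fst z).
Proof.
  intros H.
  apply (continuous_ext_loc _ (fun x =>
    sqrt (exp (2 * (s + t - 1) * Re (lg (x, snd z))) * (2 * (s ^ 2 + t ^ 2))
          * ((INR n + 1) * (c * (x - a) ^ n)) ^ 2))).
  - generalize (proj1 (open_slices U z (proj1 H) (proj1 (proj2 H)))).
    apply filter_imp; intros x Hx; symmetry.
    apply (grad_norm_ghpow n a b c (x, snd z) U lg s t).
    eapply log_branch_near_move; eassumption.
  - apply continuous_comp; [|apply continuous_sqrt].
    destruct (partials_log _ _ _ _ _ _ _ H) as [[P _] _].
    apply (continuous_mult (fun x => exp (2 * (s + t - 1) * Re (lg (x, snd z)))
             * (2 * (s ^ 2 + t ^ 2)))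
             (fun x => ((INR n + 1) * (c * (x - a) ^ n)) ^ 2)).
    + apply (continuous_mult (fun x => exp (2 * (s + t - 1) * Re (lg (x, snd z))))
               (fun _ => 2 * (s ^ 2 + t ^ 2))); [|apply continuous_const].
      apply continuous_exp_comp.
      apply (continuous_mult (fun _ => 2 * (s + t - 1))
               (fun x => Re (lg (x, snd z)))); [apply continuous_const|].
      apply @ex_derive_continuous; eexists; exact P.
    + apply @ex_derive_continuous; auto_derive; trivial.
Qed.

Lemma partials_weighted_axis n a b c y U lg (p s t : R) :
  (1 <= n)%nat -> 2 < p -> log_branch_near n a b c (a, y) U lg ->
  is_dC (fun x => (weight p n a c (ghpow lg s t) (x, y)
                   * Y1 (ghpow lg s t) (x, y))%C) a 0 /\
  is_dC (fun x => (weight p n a c (ghpow lg s t) (a, x)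
                   * Y2 n a c (ghpow lg s t) (a, x))%C) y 0.
Proof.
  intros Hn Hp H; split.
  - pose proof (proj1 (partials_ghpow_factor _ _ _ _ _ _ _ s t s t H)) as Pf.
    assert (Pk : is_derive (fun x => (INR n + 1) * (c * (x - a) ^ (n - 1))) a
              ((INR n + 1) * (c * (INR (n - 1) * (a - a) ^ pred (n - 1))))).
    { auto_derive; trivial; unfold Rminus; ring. }
    (* One factor x - a is split off phi = c (x - a)^n, which uses n >= 1. *)
    assert (EF : forall x : R, U (x, y) ->
      (RtoC ((x - a) * rpow (grad_norm n a c (ghpow lg s t) (x, y)) (p - 2)) *
       (RtoC ((INR n + 1) * (c * (x - a) ^ (n - 1))) *
        (ghpow lg s t (x, y) *
          (RtoC s * ginv lg (x, y) + RtoC t * hinv lg (x, y)))))%C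
      = (weight p n a c (ghpow lg s t) (x, y) * Y1 (ghpow lg s t) (x, y))%C).
    { intros x Hx.
      rewrite (Y1_ghpow n a b c (x, y) U lg s t)
        by (eapply log_branch_near_move; eassumption).
      unfold weight, D1_ghpow.
      replace (phi n a c (x, y)) with ((x - a) * (c * (x - a) ^ (n - 1))).
      - rewrite !RtoC_mult; ring.
      - unfold phi; simpl fst; replace n with (S (n - 1)) at 2 by lia.
        simpl pow; ring. }
    eapply is_dC_ext_loc.
    + generalize (proj1 (open_slices U _ (proj1 H) (proj1 (proj2 H)))).
      apply filter_imp; exact EF.
    + eapply is_dC_factor;
       [| |exact (is_dC_mult _ _ _ _ _ (is_dC_RtoC _ _ _ Pk) Pf)].
      * apply continuous_rpow_at_zero; [lra | intros x; apply sqrt_pos | |].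
        -- eapply grad_norm_axis; eassumption.
        -- exact (continuous_grad_norm _ _ _ _ _ _ _ s t H).
      * rewrite (grad_norm_axis n a b c y U lg) by assumption.
        apply rpow_0; lra.
  - apply (is_dC_ext_loc (fun _ => RtoC 0)); [|apply is_dC_const].
    apply filter_forall; intros x; unfold Y2.
    change (c * (fst (a, x) - a) ^ n) with (phi n a c (a, x)).
    rewrite phi_axis by exact Hn; ring.
Qed.

(** The second term of the p-Laplacian has the coefficient [phi], which is [0]
    on the line; the first is the derivative computed above. *)
Lemma plaplacian_axis n a b c y U lg (p s t : R) :
  (1 <= n)%nat -> 2 < p -> log_branch_near n a b c (a, y) U lg ->
  plaplacian_defined p n a c (ghpow lg s t) (a, y) /\
  plaplacian p n a c (ghpow lg s t) (a, y) = RtoC 0 /\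
  weight p n a c (ghpow lg s t) (a, y) = RtoC 0.
Proof.
  intros Hn Hp H.
  destruct (partials_weighted_axis _ _ _ _ _ _ _ p s t Hn Hp H)
    as [[P1 P2] [P3 P4]].
  split; [|split].
  - split; split; eexists; eassumption.
  - unfold plaplacian; unfold Y2 at 1.
    change (c * (fst (a, y) - a) ^ n) with (phi n a c (a, y)).
    rewrite phi_axis, Cmult_0_l, Cplus_0_r by exact Hn.
    apply C_ext; [exact (is_derive_unique _ _ _ P1)
                 | exact (is_derive_unique _ _ _ P2)].
  - unfold weight; rewrite (grad_norm_axis n a b c y U lg), rpow_0
      by (assumption || lra); reflexivity.
Qed.

Lemma grad_axis n a b c y U lg (s t : R) :
  (1 <= n)%nat -> log_branch_near n a b c (a, y) U lg ->
  grad n a c (ghpow lg s t) (a, y) = (RtoC 0, RtoC 0).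
Proof.
  intros Hn H; unfold grad.
  rewrite (Y1_ghpow _ _ _ _ _ _ _ s t H), (Y2_ghpow _ _ _ _ _ _ _ s t H).
  unfold D1_ghpow; rewrite phi_axis by exact Hn.
  f_equal; ring.
Qed.

(** * A smooth logarithm of g on a half-plane *)

(** The principal logarithm on the upper half-plane: there the argument of [w] is
    [PI / 2 - atan (Re w / Im w)]. *)
Definition Clog_upper (w : C) : C :=
  (ln (Re w ^ 2 + Im w ^ 2) / 2, PI / 2 - atan (Re w / Im w)).

Lemma Cexp_Clog_upper w : 0 < Im w -> Cexp (Clog_upper w) = w.
Proof.
  destruct w as [x y]; unfold Cexp, Clog_upper; simpl; intros Hy.
  assert (HN : 0 < x ^ 2 + y ^ 2) by nra.
  assert (Hs : sqrt (x ^ 2 + y ^ 2) = y * sqrt (1 + (x / y)²)).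
  { rewrite <- (sqrt_Rsqr y) at 2 by lra.
    rewrite <- sqrt_mult_alt by apply Rle_0_sqr.
    f_equal; unfold Rsqr; field; lra. }
  assert (Hr : 0 < sqrt (1 + (x / y)²)).
  { apply sqrt_lt_R0; pose proof (Rle_0_sqr (x / y)); lra. }
  change (x * (x * 1) + y * (y * 1)) with (x ^ 2 + y ^ 2).
  rewrite <- ln_sqrt, exp_ln by (exact HN || apply sqrt_lt_R0, HN).
  rewrite cos_shift, sin_shift, sin_atan, cos_atan, Hs.
  f_equal; field; lra.
Qed.

(** Real and imaginary part of [(du + i dv) / (u + i v)]. *)
Lemma is_derive_log_polar (u v : R -> R) t du dv :
  0 < v t -> is_derive u t du -> is_derive v t dv ->
  is_derive (fun x => ln (u x ^ 2 + v x ^ 2) / 2) t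
    ((du * u t + dv * v t) / (u t ^ 2 + v t ^ 2)) /\
  is_derive (fun x => PI / 2 - atan (u x / v x)) t
    ((dv * u t - du * v t) / (u t ^ 2 + v t ^ 2)).
Proof.
  intros Hv Hu Hw.
  assert (HN : 0 < u t ^ 2 + v t ^ 2) by nra.
  split.
  - apply (is_derive_eq _ _ (/ 2 * (/ (u t ^ 2 + v t ^ 2)
             * (2 * (du * u t) + 2 * (dv * v t))))).
    + apply (is_derive_ext (fun x => / 2 * ln (u x ^ 2 + v x ^ 2)));
        [intros x; simpl; field|].
      apply is_derive_scal.
      eapply is_derive_eq; [apply (is_derive_comp ln); [apply is_derive_Reals, derivable_pt_lim_ln, HN|] |].
      * apply (is_derive_plus (V := R_NormedModule));
          apply (is_derive_pow _ 2); eassumption.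
      * unfold scal, plus; simpl; unfold mult; simpl; field.
        simpl in HN; lra.
    + field; lra.
  - eapply is_derive_eq.
    + apply (is_derive_minus (V := R_NormedModule)); [apply is_derive_const|].
      apply (is_derive_comp atan); [apply is_derive_atan|].
      apply is_derive_div; [eassumption | eassumption | lra].
    + unfold scal, minus, plus, opp, zero; simpl; unfold mult; simpl.
      unfold Rsqr; field; split; [simpl in HN |]; nra.
Qed.

(** The inverse of [F t] is written as an exponential so that the derivative of a
    logarithm of [g] is literally a multiple of [ginv]. *)
Lemma is_dC_Clog_upper (F : R -> C) t l :
  0 < Im (F t) -> is_dC F t l ->
  is_dC (fun x => Clog_upper (F x)) t (l * Cexp (- Clog_upper (F t)))%C.
Proof.
  intros Hy [H1 H2].
  assert (E : Cexp (- Clog_upper (F t)) = (/ F t)%C).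
  { pose proof (Cexp_opp (Clog_upper (F t))) as E.
    rewrite (Cexp_Clog_upper _ Hy) in E.
    assert (F t <> 0%C) by (intros E0; rewrite E0 in Hy; simpl in Hy; lra).
    transitivity (/ F t * (F t * Cexp (- Clog_upper (F t))))%C.
    - field; assumption.
    - rewrite E; ring. }
  rewrite E; clear E.
  assert (HN : 0 < Re (F t) ^ 2 + Im (F t) ^ 2) by nra.
  destruct (is_derive_log_polar _ _ _ _ _ Hy H1 H2) as [P1 P2].
  split; (eapply is_derive_eq; [eassumption|]);
    unfold Cinv, Re, Im in *; simpl in *; field; lra.
Qed.

Lemma continuous_pair_C (f : R * R -> C) z :
  continuous (fun w => Re (f w)) z -> continuous (fun w => Im (f w)) z ->
  continuous f z.
Proof.
  intros H1 H2.
  apply (proj2 (filterlim_locally f (f z))); intros eps.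
  generalize (filter_and _ _ (proj1 (filterlim_locally _ _) H1 eps)
                (proj1 (filterlim_locally _ _) H2 eps)).
  apply filter_imp; intros w [B1 B2]; split; assumption.
Qed.

Definition cont_parts (f : R * R -> C) (z : R * R) : Prop :=
  continuous (fun w => Re (f w)) z /\ continuous (fun w => Im (f w)) z.

(** Coinductive reading of smoothness: a family of continuous functions that is
    stable under both partial derivatives consists of smooth functions.  The
    induction carries a function [h] that agrees with [f] on [U] only, since [D1 f]
    is known on [U] and is arbitrary elsewhere. *)
Lemma smooth_on_closed (P : (R * R -> C) -> Prop) (U : R * R -> Prop) :
  open U ->
  (forall f, P f -> forall z, U z -> cont_parts f z) ->
  (forall f, P f -> exists f1 f2, P f1 /\ P f2 /\
     forall z, U z -> partials f z (f1 z) (f2 z)) ->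
  forall f, P f -> smooth_on U f.
Proof.
  intros HU Hc Hd f Hf k.
  assert (G : forall h, (forall z, U z -> f z = h z) -> Ck_on U k h);
    [|apply G; reflexivity].
  revert f Hf; induction k as [|k IH]; intros f Hf h E; simpl.
  - intros z Hz.
    apply (continuous_ext_loc _ f).
    + exact (filter_imp _ _ E (HU z Hz)).
    + destruct (Hc f Hf z Hz); apply continuous_pair_C; assumption.
  - destruct (Hd f Hf) as (f1 & f2 & P1 & P2 & Hp).
    assert (Hh : forall z, U z -> partials h z (f1 z) (f2 z)).
    { intros z Hz; exact (partials_ext_on U f h z _ _ HU Hz E (Hp z Hz)). }
    split; [|split].
    + intros z Hz; exact (partials_ex _ _ _ _ (Hh z Hz)).
    + apply (IH f1 P1); intros z Hz; symmetry; exact (partials_D1 _ _ _ _ (Hh z Hz)).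
    + apply (IH f2 P2); intros z Hz; symmetry; exact (partials_D2 _ _ _ _ (Hh z Hz)).
Qed.

Lemma cont_parts_mult f h z :
  cont_parts f z -> cont_parts h z -> cont_parts (fun w => (f w * h w)%C) z.
Proof.
  intros [F1 F2] [G1 G2]; split; simpl.
  - apply (continuous_minus (fun w => Re (f w) * Re (h w))
             (fun w => Im (f w) * Im (h w)));
      [exact (continuous_mult _ _ _ F1 G1) | exact (continuous_mult _ _ _ F2 G2)].
  - apply (continuous_plus (fun w => Re (f w) * Im (h w))
             (fun w => Im (f w) * Re (h w)));
      [exact (continuous_mult _ _ _ F1 G2) | exact (continuous_mult _ _ _ F2 G1)].
Qed.

Lemma cont_parts_plus f h z :
  cont_parts f z -> cont_parts h z -> cont_parts (fun w => (f w + h w)%C) z.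
Proof.
  intros [F1 F2] [G1 G2]; split;
    [exact (continuous_plus _ _ _ F1 G1) | exact (continuous_plus _ _ _ F2 G2)].
Qed.

Lemma cont_parts_const k z : cont_parts (fun _ => k) z.
Proof. split; apply continuous_const. Qed.

Lemma cont_parts_RtoC (r : R * R -> R) z :
  continuous r z -> cont_parts (fun w => RtoC (r w)) z.
Proof. intros H; split; [exact H | apply continuous_const]. Qed.

Lemma continuous_pow_fst (a : R) k (z : R * R) :
  continuous (fun w : R * R => (fst w - a) ^ k) z.
Proof.
  destruct z as [x y].
  apply (continuous_comp (fun w : R * R => fst w) (fun t => (t - a) ^ k)).
  - apply continuous_fst.
  - apply @ex_derive_continuous; auto_derive; trivial.
Qed.

Lemma cont_parts_ginv lg z : cont_parts lg z -> cont_parts (ginv lg) z.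
Proof.
  intros [H1 H2].
  pose proof (continuous_opp _ _ H1) as O1.
  pose proof (continuous_opp _ _ H2) as O2.
  split; simpl.
  - apply (continuous_mult (fun w => exp (- Re (lg w))) (fun w => cos (- Im (lg w)))).
    + exact (continuous_comp _ exp _ O1 (continuous_exp _)).
    + exact (continuous_comp _ cos _ O2 (continuous_cos _)).
  - apply (continuous_mult (fun w => exp (- Re (lg w))) (fun w => sin (- Im (lg w)))).
    + exact (continuous_comp _ exp _ O1 (continuous_exp _)).
    + exact (continuous_comp _ sin _ O2 (continuous_sin _)).
Qed.

(** The polynomials in [y1 - a] and [1/g].  This family contains the derivatives
    of a logarithm of [g] and is stable under differentiation, because the
    derivatives of [1/g = Cexp (- lg)] are [- 1/g] times those of [lg]. *)
Inductive log_coeff (a : R) (lg : R * R -> C) : (R * R -> C) -> Prop :=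
| lc_const k : log_coeff a lg (fun _ => k)
| lc_pow j : log_coeff a lg (fun w => RtoC ((fst w - a) ^ j))
| lc_ginv : log_coeff a lg (ginv lg)
| lc_plus f h : log_coeff a lg f -> log_coeff a lg h ->
    log_coeff a lg (fun w => (f w + h w)%C)
| lc_mult f h : log_coeff a lg f -> log_coeff a lg h ->
    log_coeff a lg (fun w => (f w * h w)%C).

Lemma log_coeff_partials a lg (U : R * R -> Prop) l1 l2 :
  log_coeff a lg l1 -> log_coeff a lg l2 ->
  (forall z, U z -> partials lg z (l1 z) (l2 z)) ->
  forall f, log_coeff a lg f -> exists f1 f2,
    log_coeff a lg f1 /\ log_coeff a lg f2 /\
    forall z, U z -> partials f z (f1 z) (f2 z).
Proof.
  intros Hl1 Hl2 Hlg f Hf; induction Hf as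
    [k | j | | f h Hf (f1 & f2 & F1 & F2 & Pf) Hh (h1 & h2 & H1 & H2 & Ph)
     | f h Hf (f1 & f2 & F1 & F2 & Pf) Hh (h1 & h2 & H1 & H2 & Ph)].
  - exists (fun _ => RtoC 0), (fun _ => RtoC 0).
    split; [apply lc_const|]; split; [apply lc_const|].
    intros z _; apply partials_const.
  - exists (fun w => (RtoC (INR j) * RtoC ((fst w - a) ^ pred j))%C), (fun _ => RtoC 0).
    split; [apply lc_mult; [apply (lc_const _ _ (RtoC (INR j))) | apply lc_pow]|].
    split; [apply lc_const|].
    intros [x y] _; eapply partials_eq;
      [apply (partials_fst (fun t => (t - a) ^ j) (x, y)
                (INR j * (x - a) ^ pred j))| |reflexivity].
    + simpl fst; auto_derive; trivial; unfold Rminus; ring.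
    + apply RtoC_mult.
  - exists (fun w => (RtoC (-1) * (l1 w * ginv lg w))%C),
      (fun w => (RtoC (-1) * (l2 w * ginv lg w))%C).
    split; [|split];
      try (apply lc_mult; [apply (lc_const _ _ (RtoC (-1)))
           | apply lc_mult; [assumption | apply lc_ginv]]).
    intros z Hz; eapply partials_eq;
      [exact (partials_ginv_of_log _ _ _ _ (Hlg z Hz))| |]; ring.
  - exists (fun w => (f1 w + h1 w)%C), (fun w => (f2 w + h2 w)%C).
    split; [apply lc_plus; assumption|].
    split; [apply lc_plus; assumption|].
    intros z Hz; apply partials_plus; auto.
  - exists (fun w => (f1 w * h w + f w * h1 w)%C),
      (fun w => (f2 w * h w + f w * h2 w)%C).
    split; [apply lc_plus; apply lc_mult; assumption|].
    split; [apply lc_plus; apply lc_mult; assumption|].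
    intros z Hz; apply partials_mult; auto.
Qed.

Lemma log_coeff_cont a lg z f :
  cont_parts lg z -> log_coeff a lg f -> cont_parts f z.
Proof.
  intros H Hf; induction Hf.
  - apply cont_parts_const.
  - apply cont_parts_RtoC, continuous_pow_fst.
  - apply cont_parts_ginv, H.
  - apply cont_parts_plus; assumption.
  - apply cont_parts_mult; assumption.
Qed.

Definition log_g_upper (n : nat) (a b c : R) (w : R * R) : C :=
  Clog_upper (g n a b c w).

Lemma g_pair n a b c w :
  g n a b c w = (c * (fst w - a) ^ (n + 1), (INR n + 1) * (snd w - b)).
Proof. apply C_ext; unfold g; simpl; unfold Re, Im; simpl; ring. Qed.

Lemma Im_g_pos n a b c w : b < snd w -> 0 < Im (g n a b c w).
Proof.
  intros Hw; rewrite g_pair; simpl.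
  pose proof (pos_INR n); apply Rmult_lt_0_compat; lra.
Qed.

Lemma partials_log_g_upper n a b c w :
  b < snd w ->
  partials (log_g_upper n a b c) w
    (RtoC ((INR n + 1) * phi n a c w) * ginv (log_g_upper n a b c) w)%C
    (Ci * RtoC (INR n + 1) * ginv (log_g_upper n a b c) w)%C.
Proof.
  intros Hw; pose proof (Im_g_pos n a b c w Hw) as Hi.
  destruct w as [x y]; destruct (partials_g n a b c (x, y)) as [P1 P2].
  split; [exact (is_dC_Clog_upper _ _ _ Hi P1) | exact (is_dC_Clog_upper _ _ _ Hi P2)].
Qed.

Lemma cont_log_g_upper n a b c w :
  b < snd w -> cont_parts (log_g_upper n a b c) w.
Proof.
  intros Hw; pose proof (Im_g_pos n a b c w Hw) as Hi.
  assert (C1 : continuous (fun w : R * R => Re (g n a b c w)) w).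
  { apply (continuous_ext (fun w : R * R => c * (fst w - a) ^ (n + 1))).
    - intros u; rewrite g_pair; reflexivity.
    - apply (continuous_mult (fun _ => c) (fun w : R * R => (fst w - a) ^ (n + 1)));
        [apply continuous_const | apply continuous_pow_fst]. }
  assert (C2 : continuous (fun w : R * R => Im (g n a b c w)) w).
  { apply (continuous_ext (fun w : R * R => (INR n + 1) * (snd w - b))).
    - intros u; rewrite g_pair; reflexivity.
    - destruct w as [x y].
      apply (continuous_comp (fun w : R * R => snd w) (fun t => (INR n + 1) * (t - b))).
      + apply continuous_snd.
      + apply @ex_derive_continuous; auto_derive; trivial. }
  split; unfold log_g_upper, Clog_upper; simpl.
  - apply (continuous_mult (fun w : R * R => ln (Re (g n a b c w) ^ 2 + Im (g n a b c w) ^ 2))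
             (fun _ => / 2)); [|apply continuous_const].
    apply (continuous_comp (fun w : R * R => Re (g n a b c w) ^ 2 + Im (g n a b c w) ^ 2) ln).
    + apply (continuous_plus (fun w : R * R => Re (g n a b c w) ^ 2)
               (fun w : R * R => Im (g n a b c w) ^ 2));
        (apply (continuous_comp _ (fun t => t ^ 2)); [assumption|];
         apply @ex_derive_continuous; auto_derive; trivial).
    + apply continuous_ln; nra.
  - apply (continuous_minus (fun _ => PI / 2)
             (fun w : R * R => atan (Re (g n a b c w) / Im (g n a b c w))));
      [apply continuous_const|].
    apply (continuous_comp (fun w : R * R => Re (g n a b c w) / Im (g n a b c w)) atan);
      [|apply continuous_atan].
    apply (continuous_mult (fun w : R * R => Re (g n a b c w))
             (fun w : R * R => / Im (g n a b c w))); [exact C1|].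
    apply (continuous_comp (fun w : R * R => Im (g n a b c w)) Rinv); [exact C2|].
    apply continuous_Rinv; lra.
Qed.

Lemma open_upper (b : R) : open (fun w : R * R => b < snd w).
Proof.
  apply (open_comp (fun w : R * R => snd w) (fun y => b < y)).
  - intros [x y] _; apply continuous_snd.
  - apply open_gt.
Qed.

Lemma smooth_log_g_upper n a b c :
  smooth_on (fun w => b < snd w) (log_g_upper n a b c).
Proof.
  set (lg := log_g_upper n a b c).
  set (l1 := fun w : R * R => (RtoC ((INR n + 1) * c)
               * (RtoC ((fst w - a) ^ n) * ginv lg w))%C).
  set (l2 := fun w : R * R => (Ci * RtoC (INR n + 1) * ginv lg w)%C).
  assert (H1 : log_coeff a lg l1).
  { apply lc_mult; [apply (lc_const _ _ (RtoC _))|].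
    apply lc_mult; [apply lc_pow | apply lc_ginv]. }
  assert (H2 : log_coeff a lg l2).
  { apply lc_mult; [apply (lc_const _ _ (_ * _)%C) | apply lc_ginv]. }
  assert (Hlg : forall z, b < snd z -> partials lg z (l1 z) (l2 z)).
  { intros z Hz; eapply partials_eq; [apply (partials_log_g_upper n a b c z Hz)| |];
      [|reflexivity].
    unfold l1, phi; fold lg; rewrite !RtoC_mult; ring. }
  apply (smooth_on_closed (fun f => f = lg \/ log_coeff a lg f)).
  - apply open_upper.
  - intros f [->|Hf] z Hz.
    + apply cont_log_g_upper, Hz.
    + apply (log_coeff_cont a lg); [apply cont_log_g_upper, Hz | exact Hf].
  - intros f [->|Hf].
    + exists l1, l2; split; [right; exact H1|]; split; [right; exact H2 | exact Hlg].
    + destruct (log_coeff_partials a lg _ l1 l2 H1 H2 Hlg f Hf)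
        as (f1 & f2 & F1 & F2 & P).
      exists f1, f2; split; [right; exact F1|]; split; [right; exact F2 | exact P].
  - left; reflexivity.
Qed.

Lemma log_branch_upper n a b c z :
  b < snd z ->
  log_branch_near n a b c z (fun w => b < snd w) (log_g_upper n a b c).
Proof.
  intros Hz; split; [apply open_upper|]; split; [exact Hz|].
  split; [apply smooth_log_g_upper|].
  intros w Hw; apply Cexp_Clog_upper, Im_g_pos, Hw.
Qed.

(** * The uncorrected equation fails *)

(** On the line [g] is purely imaginary, so [hinv = - ginv] and
    [s q - t r = (s + t) q]; and [dphi] is the constant [c] when [n = 1]. *)
Lemma bracket_axis_neq_0 a b c y U lg (s t : R) :
  c <> 0 -> s + t <> 0 -> log_branch_near 1 a b c (a, y) U lg ->
  bracket 1 a c (ghpow lg s t) (a, y) <> RtoC 0.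
Proof.
  intros Hc Hst H; rewrite (bracket_ghpow _ _ _ _ _ _ _ s t H).
  pose proof (dphi_ginv _ _ _ _ _ _ _ (le_n 1) H) as E.
  rewrite phi_axis in E by apply le_n.
  assert (Ed : dphi 1 a c (a, y) = c) by (unfold dphi; simpl; ring).
  rewrite Ed in *.
  assert (Hc' : RtoC c <> 0%C) by (intros X; apply Hc; injection X; trivial).
  assert (Er : hinv lg (a, y) = (- ginv lg (a, y))%C).
  { transitivity (/ RtoC c * (RtoC c * (ginv lg (a, y) + hinv lg (a, y)))
                  - ginv lg (a, y))%C; [field; exact Hc' | rewrite E; ring]. }
  unfold D2_ghpow; rewrite Er.
  replace (RtoC s * ginv lg (a, y) + - RtoC t * - ginv lg (a, y))%C
    with (RtoC (s + t) * ginv lg (a, y))%C by (rewrite RtoC_plus; ring).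
  repeat apply Cmult_neq_0; try apply Cexp_neq_0.
  - exact Hc'.
  - intros X; injection X; lra.
  - intros X; injection X; simpl; lra.
  - intros X; apply Hst; injection X; trivial.
Qed.

(** * The theorem *)

Theorem theorem4p1 :
  (forall (n : nat) (a b c p L : R),
    (1 <= n)%nat -> c <> 0 -> 1 < p -> p <> INR n + 2 -> L <> 1 -> L <> -1 ->
    forall (z : R * R) (U : R * R -> Prop) (lg : R * R -> C),
      z <> (a, b) ->
      log_branch_near n a b c z U lg ->
      (p < 2 -> grad n a c (fpL n p L lg) z <> (RtoC 0, RtoC 0)) ->
      plaplacian_defined p n a c (fpL n p L lg) z /\
      (plaplacian p n a c (fpL n p L lg) z
       + Ci * RtoC (L * (p - 1)) * weight p n a c (fpL n p L lg) z
         * bracket n a c (fpL n p L lg) z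
       - weight p n a c (fpL n p L lg) z
         * RtoC (L ^ 2 / (L ^ 2 - 1) * (-4)
                 * ((p - 2) * (1 + INR n * p) / (2 + INR n - p)))
         * Y2 n a c (gpow lg (alpha n p L)) z
         * Y2 n a c (hpow lg (beta n p L)) z)%C = RtoC 0)
  /\
  (exists (n : nat) (a b c p L : R),
    ((1 <= n)%nat /\ c <> 0 /\ 1 < p /\ p <> INR n + 2 /\ L <> 1 /\ L <> -1) /\
    exists (z : R * R) (U : R * R -> Prop) (lg : R * R -> C),
      z <> (a, b) /\
      log_branch_near n a b c z U lg /\
      (p < 2 -> grad n a c (fpL n p L lg) z <> (RtoC 0, RtoC 0)) /\
      (plaplacian p n a c (fpL n p L lg) z
       + Ci * RtoC L * bracket n a c (fpL n p L lg) z)%C <> RtoC 0).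
Proof.
  split.
  - intros n a b c p L Hn Hc Hp Hpn HL1 HL2 z U lg _ H Hgrad.
    assert (Hcase : (fst z <> a \/ p = 2) \/ (fst z = a /\ 2 < p)).
    { destruct (Req_dec (fst z) a) as [Ez|Ez]; [|tauto].
      destruct (Rtotal_order p 2) as [Hlt|[E|Hgt]]; [exfalso|tauto|right; split; assumption].
      apply (Hgrad Hlt).
      destruct z as [x y]; simpl in Ez; subst x.
      exact (grad_axis _ _ _ _ _ _ _ _ _ Hn H). }
    destruct Hcase as [Hz|[Ez Hp2]].
    + exact (p_laplace_identity_regular _ _ _ _ _ _ _ _ _ Hn Hc Hp Hpn HL1 HL2 H Hz).
    + destruct z as [x y]; simpl in Ez; subst x.
      change (fpL n p L lg) with (ghpow lg (alpha n p L) (beta n p L)).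
      destruct (plaplacian_axis _ _ _ _ _ _ _ p (alpha n p L) (beta n p L) Hn Hp2 H)
        as (Hdef & Hlap & Hw).
      split; [exact Hdef|].
      rewrite Hlap, Hw; ring.
  (* With p = 4 the point (0, 1) lies in the degenerate range p > 2, and p <> n + 2
     keeps alpha + beta different from 0. *)
  - exists 1%nat, 0, 0, 1, 4, 2.
    split; [simpl INR; repeat split; (lia || lra)|].
    pose proof (log_branch_upper 1 0 0 1 (0, 1) Rlt_0_1) as H.
    exists (0, 1), (fun w => 0 < snd w), (log_g_upper 1 0 0 1).
    split; [intros E; injection E; lra|].
    split; [exact H|].
    split; [intros; lra|].
    change (fpL 1 4 2 (log_g_upper 1 0 0 1))
      with (ghpow (log_g_upper 1 0 0 1) (alpha 1 4 2) (beta 1 4 2)).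
    assert (H4 : 2 < 4) by lra.
    destruct (plaplacian_axis _ _ _ _ _ _ _ 4 (alpha 1 4 2) (beta 1 4 2) (le_n 1) H4 H)
      as (_ & -> & _).
    rewrite Cplus_0_l.
    repeat apply Cmult_neq_0.
    + intros X; injection X; lra.
    + intros X; injection X; lra.
    + refine (bracket_axis_neq_0 _ _ _ _ _ _ _ _ R1_neq_R0 _ H).
      unfold alpha, beta; simpl; lra.
Qed.
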